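(* (1) For every $x\in[0]_2$: $\mathsf{DYNM}(x,1)=\mathsf{RD}[x]=O$. (2) Let $t,i\in\mathbb{N}^*$ with $1\le i\le 2^t-1$, and let $s=\mathsf{DYNM}(i,t)\in\{I,O\}^t$. Then: (2.1) $\mathsf{DYNM}(x,t)=s$ for every $x\in[i]_{2^t}$. (2.2) For every $x\in[i]_{2^t}$: if $s(x)<x$ and this occurs for the first time (i.e. $s_{\le j}(x)\not<x$ for all $1\le j\le t-1$), then $\mathsf{RD}[x]=s$. (2.3) For $x\in[i]_{2^t}$ with $s(x)\not<x$: if $s(i)\in[0]_2$, then $\mathsf{DYNM}(x,t+1)=s\|O$ when $x\in[i]_{2^{t+1}}$, and $\mathsf{DYNM}(x,t+1)=s\|I$ when $x\in[i+2^t]_{2^{t+1}}$; if $s(i)\in[1]_2$, then $\mathsf{DYNM}(x,t+1)=s\|I$ when $x\in[i]_{2^{t+1}}$, and $\mathsf{DYNM}(x,t+1)=s\|O$ when $x\in[i+2^t]_{2^{t+1}}$.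
   Context: $\mathbb{N}^*=\{1,2,3,\dots\}$. For $m\ge2$ and $0\le i\le m-1$, $[i]_m=\{x\in\mathbb{N}^*: x\equiv i \bmod m\}$. $I(x)=(3x+1)/2$ and $O(x)=x/2$. A word $s=c_1c_2\cdots c_L$ with $c_k\in\{I,O\}$ acts by $s(x)=c_L(\cdots c_2(c_1(x)))$; its length is $|s|=L$; $\|$ is concatenation of words; $s_{\le j}=c_1\cdots c_j$ is the prefix of length $j$, with $s_{\le 0}(x)=x$. For $x,n\in\mathbb{N}^*$, $\mathsf{DYNM}(x,n)\in\{I,O\}^n$ is the word $c_1\cdots c_n$ of the first $n$ Collatz transformations of $x$: $x_0=x$; $c_k=I$ if $x_{k-1}$ is odd and $c_k=O$ if $x_{k-1}$ is even; $x_k=c_k(x_{k-1})$. Reduced dynamics: for $x\ge2$, $\mathsf{RD}[x]=s$ means that $s=\mathsf{DYNM}(x,L)$ for some $L\in\mathbb{N}^*$, $s(x)<x$, and $s_{\le j}(x)\not<x$ for $j=1,\dots,L-1$; $\mathsf{RD}[x]$ exists if there is such an $s$. By convention $\mathsf{RD}[1]=IO$. *)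

(* Defs.v *)
From mathcomp Require Import all_boot all_order all_algebra.
From mathcomp Require Import ring zify.

Set Implicit Arguments.
Unset Strict Implicit.
Unset Printing Implicit Defensive.

Import Order.TTheory GRing.Theory Num.Theory.
Local Open Scope ring_scope.

(* The letters I and O; the bare names are taken by the proof of True and by
   the zero of nat. *)
Inductive letter := cI | cO.

Definition word := seq letter.

(* Words act on rat: an arbitrary word need not keep an integer integral. *)
Definition letter_act (c : letter) (y : rat) : rat :=
  match c with
  | cI => (3 * y + 1) / 2
  | cO => y / 2
  end.

Definition word_act (s : word) (y : rat) : rat :=
  foldl (fun z c => letter_act c z) y s.

Definition resclass (m i : nat) : {pred nat} :=
  [pred x : nat | (0 < x)%N && (x == i %[mod m])].

Definition collatz_letter (x : nat) : letter := if odd x then cI else cO.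

(* The halvings are exact; see collatz_stepE. *)
Definition collatz_step (x : nat) : nat :=
  if odd x then ((3 * x + 1)./2)%N else x./2.

Lemma collatz_stepE (x : nat) :
  (collatz_step x)%:R = letter_act (collatz_letter x) x%:R.
Proof.
rewrite /collatz_step /collatz_letter.
have half_eq (a : nat) : ~~ odd a -> (a./2)%:R = a%:R / 2 :> rat.
  move=> ev_a; rewrite -[in RHS](even_halfK ev_a) -muln2 natrM.
  by field.
case: ifP => odd_x; rewrite /letter_act; last by rewrite half_eq ?odd_x.
have ev : ~~ odd (3 * x + 1) by rewrite oddD oddM odd_x.
by rewrite (half_eq _ ev) natrD natrM.
Qed.

Definition DYNM (x n : nat) : word :=
  mkseq (fun k => collatz_letter (iter k collatz_step x)) n.

Lemma size_DYNM (x n : nat) : size (DYNM x n) = n.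
Proof. exact: size_mkseq. Qed.

Lemma DYNM_orbit (x n : nat) :
  word_act (DYNM x n) x%:R = (iter n collatz_step x)%:R.
Proof.
elim: n => [//|n IHn].
by rewrite /DYNM mkseqS /word_act foldl_rcons -/(word_act _ _) IHn collatz_stepE.
Qed.

(* is_RD x s reads "RD[x] exists and equals s". *)
Definition is_RD (x : nat) (s : word) : Prop :=
  (x = 1%N /\ s = [:: cI; cO]) \/
  ((2 <= x)%N /\
   exists L : nat,
     [/\ (0 < L)%N, s = DYNM x L, word_act s x%:R < x%:R
       & forall j : nat, (1 <= j <= L - 1)%N ->
           ~~ (word_act (take j s) x%:R < x%:R)]).

Lemma take_DYNM (x n j : nat) : (j <= n)%N -> take j (DYNM x n) = DYNM x j.
Proof.
by move=> /minn_idPl le_jn; rewrite /DYNM /mkseq -map_take take_iota le_jn.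
Qed.

Lemma is_RD_unique (x : nat) (s1 s2 : word) :
  is_RD x s1 -> is_RD x s2 -> s1 = s2.
Proof.
case=> [[-> ->]|[x_ge2 [L1 [L1_gt0 -> lt1 min1]]]];
  case=> [[x1 ->]|[x_ge2' [L2 [L2_gt0 -> lt2 min2]]]] //.
- by rewrite x1 in x_ge2.
- case: (ltngtP L1 L2) => [lt12|lt21|-> //].
  + have := min2 L1; rewrite take_DYNM ?lt1; last exact: ltnW.
    by move=> H; have: false by apply: H; lia.
  + have := min1 L2; rewrite take_DYNM ?lt2; last exact: ltnW.
    by move=> H; have: false by apply: H; lia.
Qed.

(* Main.v *)
(* Each step sends x + 2 ^ t.+1 * k to T(x) + 2 ^ t * (c * k), with c = 3 or 1
   according to the parity of x.  Hence the first t letters depend only on x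
   modulo 2 ^ t, and the t-th iterate of x + 2 ^ t * k is that of x plus an odd
   multiple of k, so the parity of k decides the next letter. *)
Require Import Defs.
From mathcomp Require Import all_boot all_order all_algebra.
From mathcomp Require Import zify.

Set Implicit Arguments.
Unset Strict Implicit.
Unset Printing Implicit Defensive.

Import Order.TTheory GRing.Theory Num.Theory.
Local Open Scope ring_scope.

Lemma collatz_step_gt0 (x : nat) : (0 < x)%N -> (0 < collatz_step x)%N.
Proof. by rewrite /collatz_step; case: ifP; lia. Qed.

Lemma iter_collatz_step_gt0 (n x : nat) :
  (0 < x)%N -> (0 < iter n collatz_step x)%N.
Proof. by move=> x_gt0; elim: n => //= n; exact: collatz_step_gt0. Qed.

Lemma collatz_stepD_double (x k : nat) :
  collatz_step (x + 2 * k) =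
  (collatz_step x + (if odd x then 3 else 1) * k)%N.
Proof.
rewrite /collatz_step oddD mul2n odd_double addbF.
by case: ifP => odd_x; lia.
Qed.

Lemma DYNM_recl (x n : nat) :
  DYNM x n.+1 = collatz_letter x :: DYNM (collatz_step x) n.
Proof.
rewrite /DYNM /mkseq /= -[1%N]/(1 + 0)%N iotaDl -map_comp.
by congr (_ :: _); apply: eq_map => k /=; rewrite -iterSr.
Qed.

Lemma DYNM_recr (x n : nat) :
  DYNM x n.+1 = DYNM x n ++ [:: collatz_letter (iter n collatz_step x)].
Proof. by rewrite /DYNM mkseqS cats1. Qed.

Lemma collatz_shift (t x : nat) :
  exists2 a : nat, odd a &
    forall k : nat,
      DYNM (x + 2 ^ t * k) t = DYNM x t /\
      (iter t collatz_step (x + 2 ^ t * k) = iter t collatz_step x + a * k)%N.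
Proof.
elim: t x => [|t IHt] x.
  by exists 1%N => // k; rewrite expn0 !mul1n.
have [a odd_a shift_a] := IHt (collatz_step x).
exists (a * (if odd x then 3 else 1))%N.
  by rewrite oddM odd_a; case: (odd x).
move=> k; rewrite !DYNM_recl !iterSr expnS -mulnA collatz_stepD_double.
rewrite [((if _ then _ else _) * _)%N]mulnCA.
have [-> ->] := shift_a ((if odd x then 3 else 1) * k)%N.
split; last by rewrite -mulnA.
congr (_ :: _).
by rewrite /collatz_letter oddD mul2n odd_double addbF.
Qed.

Lemma resclassP (m i x : nat) : (i < m)%N -> x \in resclass m i ->
  exists k : nat, x = (i + m * k)%N.
Proof.
move=> lt_im; rewrite inE => /andP[_ /eqP eq_xi].
exists (x %/ m)%N; rewrite {1}(divn_eq x m) eq_xi (modn_small lt_im).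
by rewrite addnC mulnC.
Qed.

Lemma is_RD_even (x : nat) : x \in resclass 2 0 -> is_RD x [:: cO].
Proof.
rewrite inE => /andP[x_gt0 /eqP x_even]; right; split; first by lia.
have eqDYNM : DYNM x 1 = [:: cO].
  by rewrite DYNM_recl /collatz_letter ifF //; lia.
exists 1%N; split=> // [|j]; last by lia.
rewrite -eqDYNM DYNM_orbit ltr_nat /= /collatz_step; case: ifP; lia.
Qed.

Lemma is_RD_DYNM (x t : nat) : (0 < t)%N -> (0 < x)%N ->
  word_act (DYNM x t) x%:R < x%:R ->
  (forall j : nat, (1 <= j <= t - 1)%N ->
     ~~ (word_act (take j (DYNM x t)) x%:R < x%:R)) ->
  is_RD x (DYNM x t).
Proof.
move=> t_gt0 x_gt0 lt_sx min_s; right; split; last by exists t.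
move: lt_sx; rewrite DYNM_orbit ltr_nat.
exact/leq_trans/iter_collatz_step_gt0.
Qed.

Lemma DYNM_next (t i k : nat) :
  DYNM (i + 2 ^ t * k) t.+1 =
  DYNM i t ++ [:: if odd (iter t collatz_step i) (+) odd k then cI else cO].
Proof.
have [a odd_a shift_a] := collatz_shift t i.
have [eqD eqI] := shift_a k.
by rewrite DYNM_recr eqD eqI /collatz_letter oddD oddM odd_a.
Qed.

Theorem theorem2p7 :
  (forall x : nat, x \in resclass 2 0 -> DYNM x 1 = [:: cO] /\ is_RD x [:: cO])
  /\
  (forall (t i : nat) (s : word),
     (0 < t)%N -> (1 <= i <= 2 ^ t - 1)%N -> s = DYNM i t ->
     [/\ forall x : nat, x \in resclass (2 ^ t) i -> DYNM x t = s,
         forall x : nat, x \in resclass (2 ^ t) i ->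
           word_act s x%:R < x%:R ->
           (forall j : nat, (1 <= j <= t - 1)%N ->
              ~~ (word_act (take j s) x%:R < x%:R)) ->
           is_RD x s
       & forall x : nat, x \in resclass (2 ^ t) i ->
           ~~ (word_act s x%:R < x%:R) ->
           ((exists2 n : nat, word_act s i%:R = n%:R & n \in resclass 2 0) ->
              (x \in resclass (2 ^ t.+1) i -> DYNM x t.+1 = s ++ [:: cO])
              /\ (x \in resclass (2 ^ t.+1) (i + 2 ^ t) ->
                    DYNM x t.+1 = s ++ [:: cI]))
           /\
           ((exists2 n : nat, word_act s i%:R = n%:R & n \in resclass 2 1) ->
              (x \in resclass (2 ^ t.+1) i -> DYNM x t.+1 = s ++ [:: cI])
              /\ (x \in resclass (2 ^ t.+1) (i + 2 ^ t) ->
                    DYNM x t.+1 = s ++ [:: cO]))]).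
Proof.
split=> [x x_even|t i s t_gt0 i_bnd ->].
  split; last exact: is_RD_even.
  move: x_even; rewrite inE => /andP[_ /eqP x_even].
  by rewrite DYNM_recl /collatz_letter ifF //; lia.
have lt_it : (i < 2 ^ t)%N by lia.
have DYNM_class x : x \in resclass (2 ^ t) i -> DYNM x t = DYNM i t.
  case/(resclassP lt_it) => k ->.
  by have [a _ shift_a] := collatz_shift t i; have [] := shift_a k.
have next_low x : x \in resclass (2 ^ t.+1) i -> DYNM x t.+1 =
    DYNM i t ++ [:: if odd (iter t collatz_step i) then cI else cO].
  case/resclassP => [|k ->]; first by rewrite expnS; lia.
  by rewrite expnSr -mulnA DYNM_next mul2n odd_double addbF.
have next_high x : x \in resclass (2 ^ t.+1) (i + 2 ^ t) -> DYNM x t.+1 =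
    DYNM i t ++ [:: if odd (iter t collatz_step i) then cO else cI].
  case/resclassP => [|k ->]; first by rewrite expnS; lia.
  have -> : (i + 2 ^ t + 2 ^ t.+1 * k = i + 2 ^ t * k.*2.+1)%N.
    by rewrite expnSr -mulnA mul2n mulnS addnA.
  by rewrite DYNM_next /= odd_double addbT; case: odd.
have odd_iter r : (exists2 n : nat,
    word_act (DYNM i t) i%:R = n%:R & n \in resclass 2 r) ->
    odd (iter t collatz_step i) = odd r.
  case=> n; rewrite DYNM_orbit => /eqP; rewrite eqr_nat => /eqP ->.
  by rewrite inE => /andP[_ /eqP]; rewrite !modn2; do 2!case: odd.
split=> // [x x_i lt_sx min_s|x _ _].
  have x_gt0 : (0 < x)%N by move: x_i; rewrite inE => /andP[].
  by move: lt_sx min_s; rewrite -(DYNM_class x x_i); exact: is_RD_DYNM.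
by split=> /odd_iter par; split; [move/next_low | move/next_high
  | move/next_low | move/next_high]; rewrite par.
Qed.
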